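(* For any separable metric space $(\mathcal{X},\rho)$ (with its Borel $\sigma$-algebra $\mathcal{B}$), $\mathrm{FMV}=\mathrm{FS}$. That is, a stochastic process $\mathbb{X}$ on $\mathcal{X}$ takes only finitely many distinct values almost surely if and only if for every countable measurable partition $\{A_k\}_{k\ge1}$ of $\mathcal{X}$, almost surely $\mathbb{X}$ visits only finitely many of the sets $A_k$.
   Context: $\mathrm{FS}$: the set of processes $\mathbb{X}=(X_t)_{t\ge1}$ with $\#\{x\in\mathcal{X}:\exists t,\ X_t=x\}<\infty$ a.s. $\mathrm{FMV}$: the set of processes $\mathbb{X}$ such that for every sequence of pairwise disjoint sets $\{A_k\}_{k\ge1}\subset\mathcal{B}$ with $\bigcup_kA_k=\mathcal{X}$, $\#\{k\in\mathbb{N}: \exists t,\ X_t\in A_k\}<\infty$ almost surely. *)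

(* Defs.v *)
From HB Require Import structures.
From mathcomp Require Import all_boot all_order all_algebra.
From mathcomp Require Import all_classical all_reals all_analysis.
Set Implicit Arguments. Unset Strict Implicit. Unset Printing Implicit Defensive.
Import Order.TTheory GRing.Theory Num.Theory.
Local Open Scope classical_set_scope.
Local Open Scope ring_scope.

Definition borel_set (T : topologicalType) (B : set T) : Prop := <<s open >> B.

Definition separable (T : topologicalType) : Prop :=
  exists D : set T, countable D /\ dense D.

Definition process {d} (Omega : measurableType d) (T : topologicalType)
  (X : nat -> Omega -> T) : Prop :=
  forall t, (0 < t)%N -> forall B, borel_set B -> measurable (X t @^-1` B).

Definition FS {d} (R : realType) (Omega : measurableType d)
  (P : probability Omega R) (T : topologicalType) (X : nat -> Omega -> T) : Prop :=
  \forall w \ae P, finite_set [set x | exists t, (0 < t)%N /\ X t w = x].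

Definition FMV {d} (R : realType) (Omega : measurableType d)
  (P : probability Omega R) (T : topologicalType) (X : nat -> Omega -> T) : Prop :=
  forall A : nat -> set T,
    (forall k, (0 < k)%N -> borel_set (A k)) ->
    (forall k l, (0 < k)%N -> (0 < l)%N -> k <> l -> A k `&` A l = set0) ->
    \bigcup_(k in [set k | (0 < k)%N]) A k = setT ->
    \forall w \ae P,
      finite_set [set k | (0 < k)%N /\ exists t, (0 < t)%N /\ A k (X t w)].

(* Main.v *)
(* Only FMV -> FS is substantial. Fix countably many open sets separating the
   points of T; the first n of them cut T into finitely many cells. If X takes
   infinitely many values, then for large n its first n values occupy at least m
   cells. Colour the cells uniformly at random with K + 1 colours and let B be
   the union of the cells of colour 0: with high probability B is hit by the
   process (m large) but avoided by its first N values (K large). By averaging,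
   some deterministic colouring does this up to an event of small probability.
   Taking N = k and error 2^-(k+1) gives Borel sets B_k such that, by
   Borel-Cantelli, almost surely every X_t lies in only finitely many B_k, while
   on the event of infinitely many values all but finitely many B_k are hit.
   Hence on that event infinitely many of the disjoint sets
   B_k minus (union of the B_j, j > k) are visited, contradicting FMV. *)
Require Import Defs.
From HB Require Import structures.
From mathcomp Require Import all_boot all_order all_algebra.
From mathcomp Require Import all_classical all_reals all_analysis.
From mathcomp Require Import measurable_realfun.
Import Order.TTheory GRing.Theory Num.Theory.
Local Open Scope classical_set_scope.
Local Open Scope ring_scope.

(** * The easy inclusion *)

Lemma FS_FMV (R : realType) (T : topologicalType)
  (d : measure_display) (Omega : measurableType d) (P : probability Omega R)
  (X : nat -> Omega -> T) : FS P X -> FMV P X.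
Proof.
move=> fsX A _ disjA covA.
have ex x : exists k, (0 < k)%N /\ A k x.
  have [k k0 Akx] : (\bigcup_(k in [set k | (0 < k)%N]) A k) x
    by rewrite covA.
  by exists k.
(* By disjointness every visited index is [kap] of a value taken, so the visited indices lie in the
   image of a finite set. *)
have [kap kapP] := choice ex.
apply: filterS fsX => w fin.
apply: sub_finite_set (finite_image kap fin) => k /= [k0 [t [t0 Akt]]].
exists (X t w); first by exists t.
have [kap0 Akap] := kapP (X t w).
apply: contrapT => kk.
by have : (A (kap (X t w)) `&` A k) (X t w) by []; rewrite disjA.
Qed.

(** * Countably many open sets separating points *)

Lemma separating_open_sets (R : realType) (T : pseudoMetricType R)
    (hT : hausdorff_space T) (sepT : separable T) :
  exists U : nat -> set T, (forall i, open (U i)) /\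
    forall x y, x <> y -> exists i, U i x /\ ~ U i y.
Proof.
have [D [/countable_injP[g ginj] dD]] := sepT.
(* Balls centred in the dense set with radii 1/(j+1), coded by pairs of naturals. Balls need not be
   open here, hence the interiors. *)
pose V (kj : nat * nat) := [set y | exists x, [/\ D x, g x = kj.1 &
  (ball x kj.2.+1%:R^-1)° y]].
exists (fun i => oapp V set0 (unpickle i)); split.
  move=> i; case: unpickle => [kj|] /=; last exact: open0.
  suff -> : V kj = \bigcup_(x in [set x | D x /\ g x = kj.1])
      (ball x kj.2.+1%:R^-1)°.
    by apply: bigcup_open => x _; exact: open_interior.
  apply/seteqP; split=> y /=; first by case=> x [? ? ?]; exists x.
  by case=> x [? ?] ?; exists x.
move=> x y xy.
have [e e0 xey] : exists2 e : R, 0 < e & ~ ball x e y.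
  move: (hT); rewrite ball_hausdorff => /(_ x y); case; first exact/eqP.
  move=> [e f] /= /eqP xfy; exists e%:num => // exy.
  have : (ball x e%:num `&` ball y f%:num) y by split => //; exact: ballxx.
  by rewrite xfy.
have [j je] : exists j : nat, j.+1%:R^-1 < e / 2 :> R.
  have e20 : 0 < e / 2 by rewrite divr_gt0.
  have [j _ jP] := near_infty_natSinv_lt (PosNum e20).
  by exists j; apply: jP => /=.
set r : R := j.+1%:R^-1 in je.
have r0 : 0 < r by rewrite invr_gt0.
(* With z this close to x, a point y of the r-ball around z would be within r/2 + r <= e of x. *)
have [z [xz Dz]] : (ball x (r / 2))° `&` D !=set0.
  apply: dD; last exact: open_interior.
  by exists x; apply: nbhsx_ballx; rewrite divr_gt0.
exists (pickle (g z, j)); rewrite pickleK /=; split.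
  exists z; split => //=; apply/nbhs_ballP; exists (r / 2) => /=.
    by rewrite divr_gt0.
  move=> u xu; rewrite -/r (splitr r); apply: ball_triangle xu.
  exact/ball_sym/(interior_subset xz).
move=> [z' [Dz' gz zy]]; apply: xey.
have zz' : z' = z by apply: ginj => //; rewrite inE.
rewrite zz' /= in zy; apply: (@le_ball _ _ _ (r / 2 + r)); last first.
  apply: ball_triangle (interior_subset zy).
  exact: interior_subset xz.
rewrite (splitr e) lerD //; last exact: ltW.
apply: le_trans (ltW je); rewrite ler_pdivrMr// ler_peMr//; first exact: ltW.
by rewrite ler1n.
Qed.


(** * Events determined by finitely many sets *)

Lemma sigma_algebra_bigcup_countType (Omega : Type) (M : set_system Omega)
    (I : countType) (F : I -> set Omega) :
  sigma_algebra [set: Omega] M -> (forall i, M (F i)) -> M (\bigcup_i F i).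
Proof.
move=> [M0 _ MU] MF.
have -> : \bigcup_i F i = \bigcup_n oapp F set0 (unpickle n).
  apply/seteqP; split=> w /= [].
    by move=> i _ Fiw; exists (pickle i) => //=; rewrite pickleK.
  by move=> n _; case: unpickle => //= i Fiw; exists i.
by apply: MU => n; case: unpickle.
Qed.

(** Such a set is a finite union of atoms, one for each truth table satisfying [Q]. [M] is kept
    abstract to serve both for Borel sets of T and for events of [Omega]. *)
Lemma sigma_algebra_finitely_generated (Omega : Type) (M : set_system Omega)
    (I : finType) (H : I -> set Omega) (Q : {ffun I -> bool} -> Prop) :
  sigma_algebra [set: Omega] M -> (forall i, M (H i)) ->
  M [set w | Q [ffun i => `[< H i w >]]].
Proof.
move=> sM MH.
have MC A : M A -> M (~` A) by case: sM => _ MD _ /MD; rewrite setTD.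
have -> : [set w | Q [ffun i => `[< H i w >]]] =
   \bigcup_q (if `[< Q q >] then
     ~` (\bigcup_i (if q i then ~` H i else H i)) else set0).
  apply/seteqP; split=> w /=.
    move=> Qw; exists [ffun i => `[< H i w >]] => //; rewrite asboolT//.
    by move=> [i _]; rewrite ffunE; case: asboolP.
  case=> q _; case: asboolP => // Qq qw; rewrite (_ : finfun _ = q)//.
  apply/ffunP => i; rewrite ffunE; case qi: (q i).
    apply/asboolP; apply: contrapT => Hiw.
    by apply: qw; exists i; rewrite ?qi.
  by apply/asboolPn => Hiw; apply: qw; exists i; rewrite ?qi.
apply: (@sigma_algebra_bigcup_countType _ M) => // q.
case: asboolP => Qq; last by case: sM.
apply/MC/(@sigma_algebra_bigcup_countType _ M) => // i.
by case: (q i) => //; exact: MC.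
Qed.

(** * Random colourings by counting *)

Lemma card_coloring (R : realType) (Q C : finType) (V : {set Q}) (p : pred C) :
  (0 < #|C|)%N ->
  #|[set f : {ffun Q -> C} | [forall q in V, p (f q)]]%SET|%:R =
  (#|p|%:R / #|C|%:R) ^+ #|V| * #|{ffun Q -> C}|%:R :> R.
Proof.
move=> C0.
have -> : #|[set f : {ffun Q -> C} | [forall q in V, p (f q)]]%SET| =
    #|family (fun q => if q \in V then p else predT)|.
  apply: eq_card => f; rewrite inE; apply/forall_inP/familyP => [h q|h q qV].
    by case: ifPn => // /h.
  by have := h q; rewrite qV.
rewrite card_family card_ffun foldrE big_map big_enum /=.
rewrite (bigID (mem V)) /= (eq_bigr (fun=> #|p|)); last by move=> q ->.
rewrite [X in (_ * X)%N](eq_bigr (fun=> #|C|)); last by move=> q /negbTE ->.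
rewrite !prod_nat_const -(cardC (mem V)) natrM !natrX exprD mulrA.
congr (_ * _); have -> : #|mem V| = #|V| by exact: eq_card.
by rewrite expr_div_n divfK // expf_neq0 // pnatr_eq0 -lt0n.
Qed.

(** The sum of the [P (E f)] is the expected number of f whose event occurs, at most c times the
    number of all f; hence some term is at most c. *)
Lemma probability_averaging (R : realType) (d : measure_display)
    (Omega : measurableType d) (P : probability Omega R)
    (F : finType) (E : F -> set Omega) (c : R) : (0 < #|F|)%N ->
  (forall f, measurable (E f)) ->
  (forall w, #|[set f : F | `[< E f w >]]%SET|%:R <= c * #|F|%:R) ->
  exists f, (P (E f) <= c%:E)%E.
Proof.
move=> F0 mE Ec; apply: contrapT => nEc.
have cE f : (c%:E < P (E f))%E.
  by rewrite ltNge; apply/negP => Pf; apply: nEc; exists f.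
have : (\sum_f P (E f) <= (c * #|F|%:R)%:E)%E.
  have -> : (\sum_f P (E f) = \int[P]_w \sum_f (\1_(E f) w)%:E)%E.
    rewrite ge0_integral_sum//.
      by apply: eq_bigr => f _; rewrite integral_indic// setIT.
    by move=> f; apply/measurable_EFinP; exact: measurable_indic.
  apply: le_trans (_ : (\int[P]_w cst (c * #|F|%:R)%:E w <= _)%E).
    apply: ge0_le_integral => //.
    - by move=> w _; apply: sume_ge0 => f _; rewrite lee_fin.
    - apply: emeasurable_sum => f; apply/measurable_EFinP.
      exact: measurable_indic.
    - move=> w _; rewrite sumEFin lee_fin; apply: le_trans (Ec w).
      rewrite -sum1_card natr_sum [leRHS]big_mkcond /=.
      apply: ler_sum => f _; rewrite indicE inE.
      by case: asboolP => Ef; [rewrite mem_set|rewrite memNset].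
  rewrite integral_cst//= -[leRHS]mule1 -(probability_setT P).
  exact: lexx.
rewrite leNgt => /negP; apply.
apply: le_lt_trans (_ : (_ <= \sum_(f : F) c%:E)%E) _.
  by rewrite sumEFin sumr_const mulr_natr.
case/card_gt0P : F0 => f _.
rewrite (bigD1 f)//= [ltRHS](bigD1 f)//=; apply: lte_leD => //.
  by rewrite sumEFin.
by apply: lee_sum => g _; exact: ltW.
Qed.

(** * Cells of the first n open sets, coded by membership vectors *)

Definition cell {T : Type} (U : nat -> set T) n x : {ffun 'I_n -> bool} :=
  [ffun i : 'I_n => `[< U i x >]].

(** Pick m distinct values and a separating index for each ordered pair; any n beyond these indices
    and the times of the values puts them in distinct visited cells. *)
Lemma cells_unbounded {T : Type} (U : nat -> set T) (x : nat -> T) m :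
  (forall x y, x <> y -> exists i, U i x /\ ~ U i y) ->
  infinite_set (range x) ->
  exists n0, forall n, (n0 <= n)%N ->
    (m <= #|[set cell U n (x t) | t : 'I_n]%SET|)%N.
Proof.
move=> sepU /infiniteP /card_leP[f0].
pose f k : T := val (f0 (SigSub (in_setT k))).
have f_inj : injective f.
  by move=> i j /val_inj /(inj (mem_set I) (mem_set I)) /(congr1 val).
have ex k : exists t, x t = f k.
  have [t _ ?] : range x (f k) by exact/set_mem/valP.
  by exists t.
have [tau tauP] := choice ex.
have ex2 (ij : nat * nat) : exists l, ij.1 <> ij.2 ->
    U l (f ij.1) /\ ~ U l (f ij.2).
  have [e|ne] := pselect (ij.1 = ij.2); first by exists 0%N.
  have [|l lP] := sepU (f ij.1) (f ij.2); last by exists l.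
  by move=> /f_inj.
have [l lP] := choice ex2.
exists (\max_(i < m)
  (maxn (tau i).+1 (\max_(j < m) (l (val i, val j)).+1))) => n.
move=> /bigmax_leqP nP.
have taun (i : 'I_m) : (tau i < n)%N.
  by have := nP i erefl; rewrite geq_max => /andP[].
have ln (i j : 'I_m) : (l (val i, val j) < n)%N.
  by have := nP i erefl; rewrite geq_max => /andP[_ /bigmax_leqP]; exact.
have finj : injective (fun i : 'I_m => cell U n (f i)).
  move=> i j /ffunP ij; apply: contrapT => nij.
  have [] := lP (val i, val j); first by move=> /= /val_inj.
  move=> Ui nUj; have := ij (Ordinal (ln i j)).
  by rewrite !ffunE /= (asboolT Ui) (asboolF nUj).
rewrite -[leqLHS]card_ord -(card_imset _ finj); apply: subset_leq_card.
apply/fintype.subsetP => _ /imsetP[i _ ->]; apply/imsetP.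
by exists (Ordinal (taun i)) => //; rewrite /= tauP.
Qed.

Lemma probability_nonincreasing_small (R : realType) (d : measure_display)
    (Omega : measurableType d) (P : probability Omega R) (D : nat -> set Omega)
    (e : R) (N : nat) : 0 < e -> (forall n, measurable (D n)) ->
  {homo D : n m / (n <= m)%N >-> m `<=` n} -> \bigcap_n D n = set0 ->
  exists2 n, (N <= n)%N & (P (D n) <= e%:E)%E.
Proof.
move=> e0 mD homD D0.
have cv : P \o D @ \oo --> 0%E.
  rewrite -(measure0 P) -D0; apply: nonincreasing_cvg_mu => //.
  - by rewrite (le_lt_trans (probability_le1 P (mD _)))// ltry.
  - exact: bigcap_measurable.
  - by move=> n m nm; apply/subsetPset; exact: homD.
have lt_e : \forall n \near \oo, (P (D n) < e%:E)%E.
  move/fine_cvgP : cv => [_ /cvgr_lt /(_ _ e0)]; apply: filterS => n /=.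
  by rewrite -lte_fin fineK// fin_num_measure.
have [n [Nn ne]] : exists n, (N <= n)%N /\ (P (D n) < e%:E)%E.
  apply: (@filter_ex _ \oo); apply: filterS2 (nbhs_infty_ge N) lt_e.
  by move=> n.
by exists n => //; exact: ltW.
Qed.

(** A union bound: each entry of [s] gets colour 0 with probability 1/(K+1), and all of [V] misses
    it with probability (K/(K+1))^#|V|. First [K], then [m], makes each part at most e/2, uniformly
    in the number of cells. *)
Lemma exists_coloring_bound (R : realType) (e : R) (N : nat) : 0 < e ->
  exists K m : nat, forall (Q : finType) (V : {set Q}) (s : seq Q),
    (size s <= N)%N ->
    #|[set f : {ffun Q -> 'I_K.+1} |
        ((m <= #|V|)%N && [forall q in V, f q != ord0])
        || has (fun q => f q == ord0) s]%SET|%:R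
    <= e * #|{ffun Q -> 'I_K.+1}|%:R :> R.
Proof.
move=> e0; have e20 : 0 < e / 2 by rewrite divr_gt0.
have [K NK] : exists K : nat, N%:R / K.+1%:R <= e / 2 :> R.
  exists (Num.truncn (N%:R / (e / 2))); rewrite ler_pdivrMr// mulrC.
  by rewrite -ler_pdivrMr// ltW// truncnS_gt.
pose r : R := K%:R / K.+1%:R.
have r0 : 0 <= r by rewrite divr_ge0.
have r1 : r < 1 by rewrite ltr_pdivrMr// mul1r ltr_nat.
have [m rm] : exists m, r ^+ m <= e / 2.
  have : r ^+ n @[n --> \oo] --> 0 by apply: cvg_expr; rewrite ger0_norm.
  move=> /cvgr_lt /(_ _ e20) /filter_ex[m /ltW rm].
  by exists m.
exists K, m => Q V s sN; set F := #|{ffun _ -> _}|.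
have cardC : #|'I_K.+1| = K.+1 by rewrite card_ord.
pose B q := [set f : {ffun Q -> 'I_K.+1} | f q == ord0]%SET.
pose A := [set f : {ffun Q -> 'I_K.+1} |
   (m <= #|V|)%N && [forall q in V, f q != ord0]]%SET.
have cA : #|A|%:R <= e / 2 * F%:R :> R.
  have [mV|mV] := leqP m #|V|; last first.
    have -> : A = finset.set0 by apply/finset.setP => f; rewrite !inE leqNgt mV.
    by rewrite cards0 mulr_ge0// ltW.
  have -> : A = [set f : {ffun Q -> 'I_K.+1} |
      [forall q in V, predC1 ord0 (f q)]]%SET.
    by apply/finset.setP => f; rewrite !inE mV.
  rewrite (card_coloring _ _ _ _ (predC1 ord0)) ?cardC// cardC1 cardC /=.
  rewrite ler_wpM2r//; apply: le_trans rm; apply: ler_wiXn2l => //.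
  exact: ltW.
have cB q : #|B q|%:R = K.+1%:R^-1 * F%:R :> R.
  have -> : B q = [set f : {ffun Q -> 'I_K.+1} |
      [forall q' in [set q]%SET, pred1 ord0 (f q')]]%SET.
    apply/finset.setP => f; rewrite !inE; apply/idP/forall_inP => [fq q'|].
      by rewrite inE => /eqP ->.
    by move=> /(_ q); rewrite inE eqxx => /(_ erefl).
  rewrite (card_coloring _ _ _ _ (pred1 ord0)) ?cardC// card1 cards1.
  by rewrite expr1 mul1r.
have cBs : #|[set f : {ffun Q -> 'I_K.+1} |
      has (fun q => f q == ord0) s]%SET|%:R
    <= (size s)%:R / K.+1%:R * F%:R :> R.
  elim: s {sN} => [|q s IH] /=.
    have -> : [set _ | false]%SET = finset.set0 :> {set {ffun Q -> 'I_K.+1}}.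
      by apply/finset.setP => f; rewrite !inE.
    by rewrite cards0 !mul0r.
  have -> : [set f : {ffun Q -> 'I_K.+1} |
      (f q == ord0) || has (fun q => f q == ord0) s]%SET =
      (B q :|: [set f : {ffun Q -> 'I_K.+1} |
        has (fun q => f q == ord0) s])%SET.
    by apply/finset.setP => f; rewrite !inE.
  apply: (@le_trans _ _ ((#|B q| + #|[set f : {ffun Q -> 'I_K.+1} |
      has (fun q => f q == ord0) s]%SET|)%:R)).
    by rewrite ler_nat leq_card_setU.
  by rewrite natrD cB -[(size s).+1%:R]natr1 !mulrDl mul1r addrC lerD2r.
have -> : [set f : {ffun Q -> 'I_K.+1} |
        ((m <= #|V|)%N && [forall q in V, f q != ord0])
        || has (fun q => f q == ord0) s]%SET =
  (A :|: [set f : {ffun Q -> 'I_K.+1} | has (fun q => f q == ord0) s])%SET.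
  by apply/finset.setP => f; rewrite !inE.
apply: (@le_trans _ _ ((#|A| + #|[set f : {ffun Q -> 'I_K.+1} |
      has (fun q => f q == ord0) s]%SET|)%:R)).
  by rewrite ler_nat leq_card_setU.
rewrite natrD [e]splitr mulrDl lerD// (le_trans cBs)// ler_wpM2r//.
by apply: le_trans NK; rewrite ler_pM2r ?invr_gt0// ler_nat.
Qed.

(** * One Borel set hit late, up to a small error *)

Lemma exists_sparse_hitting_set (R : realType) (T : topologicalType)
    (d : measure_display) (Omega : measurableType d) (P : probability Omega R)
    (X : nat -> Omega -> T) (U : nat -> set T) (e : R) (N : nat) :
  process X -> (forall i, open (U i)) ->
  (forall x y, x <> y -> exists i, U i x /\ ~ U i y) -> 0 < e ->
  exists B Bad, [/\ borel_set B, measurable Bad, (P Bad <= e%:E)%E &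
    forall w, ~ Bad w ->
      (infinite_set (range (fun t => X t.+1 w)) -> exists t, B (X t.+1 w)) /\
      (forall t, (t < N)%N -> ~ B (X t.+1 w))].
Proof.
move=> hX oU sepU e0; have e20 : 0 < e / 2 by rewrite divr_gt0.
have [K [m Km]] := exists_coloring_bound _ _ N e20.
(* The finite table [hist n w] determines the cells of the first n values, so
   every event about these cells is measurable. *)
pose hist n w := [ffun ti : 'I_n * 'I_n => `[< U ti.2 (X ti.1.+1 w) >]].
pose hcell n (h : {ffun 'I_n * 'I_n -> bool}) t := [ffun i => h (t, i)].
have hcellE n w t : hcell n (hist n w) t = cell U n (X t.+1 w).
  by apply/ffunP => i; rewrite !ffunE.
have mhist n (Q : {ffun 'I_n * 'I_n -> bool} -> Prop) :
    measurable [set w | Q (hist n w)].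
  apply: (sigma_algebra_finitely_generated _ measurable ('I_n * 'I_n)%type
    (fun ti w => U ti.2 (X ti.1.+1 w)) Q).
    exact: sigma_algebra_measurable.
  by move=> ti; apply: hX => //; exact: sub_sigma_algebra.
pose V n h := [set hcell n h t | t : 'I_n]%SET.
pose G n := [set w | (m <= #|V n (hist n w)|)%N].
have mG n : measurable (G n) by exact: (mhist n (fun h => (m <= #|V n h|)%N)).
(* Intersecting over all j >= n makes [L] increasing by construction, so that [D n] decreases to the
   empty set. *)
pose L n := \bigcap_(j in [set j | (n <= j)%N]) G j.
have mL n : measurable (L n) by apply: bigcap_measurableType.
pose D n := (\bigcup_j L j) `\` L n.
have mD n : measurable (D n).
  by apply: measurableD => //; exact: bigcupT_measurable.
have [n Nn PD] : exists2 n, (N <= n)%N & (P (D n) <= (e / 2)%:E)%E.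
  apply: probability_nonincreasing_small => //.
    move=> i j ij w [LUw nLw]; split => //; apply: contra_not nLw => Lw k /= jk.
    by apply: Lw => /=; exact: leq_trans jk.
  apply/seteqP; split => // w Dw; have [[j _ Ljw] _] := Dw 0%N I.
  by have [_] := Dw j I; exact.
(* The colouring fails if at least m cells are visited but none has colour 0, or if one of the first
   N values lies in a cell of colour 0. *)
pose bad (f : {ffun {ffun 'I_n -> bool} -> 'I_K.+1}) h :=
  ((m <= #|V n h|)%N && [forall q in V n h, f q != ord0]) ||
  has (fun q => f q == ord0) [seq hcell n h (widen_ord Nn t) | t <- enum 'I_N].
have [|||f Pf] := probability_averaging R d Omega P _
    (fun f => [set w | bad f (hist n w)]) (e / 2).
- by apply/card_gt0P; exists [ffun=> ord0].
- by move=> f; exact: (mhist n (fun h => bad f h)).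
- move=> w; rewrite (_ : [set f | _]%SET = [set f | bad f (hist n w)]%SET).
    by apply: Km; rewrite size_map size_enum_ord.
  by apply/finset.setP => f; rewrite !inE; apply/asboolP/idP.
exists [set x | f (cell U n x) = ord0], ([set w | bad f (hist n w)] `|` D n).
split.
- apply: (sigma_algebra_finitely_generated _ _ 'I_n (fun i => U i)
    (fun q => f q = ord0)).
    exact: smallest_sigma_algebra.
  by move=> i; exact: sub_sigma_algebra.
- by apply: measurableU => //; exact: (mhist n (fun h => bad f h)).
- apply: le_trans (measureU2 _ _ _) _ => //.
    exact: (mhist n (fun h => bad f h)).
  by rewrite [e]splitr EFinD leeD.
move=> w /not_orP[/negP nbad nD].
move: nbad; rewrite negb_or => /andP[nhit /hasPn nB].
split=> [inf|t tN ft]; last first.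
  have /nB := map_f (fun t => hcell n (hist n w) (widen_ord Nn t))
    (mem_enum 'I_N (Ordinal tN)).
  by rewrite hcellE /= ft eqxx.
have [n0 n0P] := cells_unbounded U (fun t => X t.+1 w) m sepU inf.
have VE j : V j (hist j w) = [set cell U j (X t.+1 w) | t : 'I_j]%SET.
  by apply: eq_imset => t; rewrite hcellE.
(* Being outside [D n], w then lies in [L n] itself: m cells are already visited at the fixed level
   n. *)
have LUw : (\bigcup_j L j) w.
  by exists n0 => // j /= n0j; rewrite /G /= VE; exact: n0P.
move: nhit; have -> /= : (m <= #|V n (hist n w)|)%N.
  have : L n w by apply: contrapT => nL; apply: nD.
  by move=> /(_ n); apply; rewrite /= leqnn.
rewrite negb_forall_in => /exists_inP[_ /imsetP[t _ ->]]; rewrite negbK hcellE.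
by move=> /eqP ft; exists t.
Qed.

(** * The substantial inclusion *)

Lemma FMV_FS (R : realType) (T : pseudoMetricType R)
  (hT : hausdorff_space T) (sepT : separable T)
  (d : measure_display) (Omega : measurableType d) (P : probability Omega R)
  (X : nat -> Omega -> T) (hX : process X) :
  FMV P X -> FS P X.
Proof.
move=> fmv; have [U [oU sepU]] := separating_open_sets R T hT sepT.
have ex k : exists BBad : set T * set Omega,
   [/\ borel_set BBad.1, measurable BBad.2,
     (P BBad.2 <= (1 / (2 ^ k.+1)%:R)%:E)%E &
    forall w, ~ BBad.2 w ->
    (infinite_set (range (fun t => X t.+1 w)) -> exists t, BBad.1 (X t.+1 w)) /\
      (forall t, (t < k)%N -> ~ BBad.1 (X t.+1 w))].
  have e0 : 0 < 1 / (2 ^ k.+1)%:R :> R by rewrite divr_gt0// ltr0n expn_gt0.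
  have [B [Bad H]] :=
    exists_sparse_hitting_set R T d Omega P X U _ k hX oU sepU e0.
  by exists (B, Bad).
have [BBad HB] := choice ex.
pose B k := (BBad k).1; pose Bad k := (BBad k).2.
have mB : forall k, borel_set (B k) by move=> k; have [] := HB k.
have mBad k : measurable (Bad k) by have [] := HB k.
have sT : sigma_algebra [set: T] (@borel_set T).
  exact: smallest_sigma_algebra.
have [b0 bD bU] := sT.
have bC (A : set T) : borel_set A -> borel_set (~` A).
  by move=> bA; have := bD A bA; rewrite setTD.
(* Borel-Cantelli: the bounds 1/2^(k+1) have a finite sum. *)
have Bad0 : P (lim_sup_set Bad) = 0%E.
  apply: lim_sup_set_cvg0 => //.
  apply: le_lt_trans (_ : (_ <= \sum_(0 <= k <oo) (1 / (2 ^ k.+1)%:R)%:E)%E) _.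
    by apply: lee_nneseries => // k _; have [] := HB k.
  by apply: le_lt_trans (epsilon_trick0 _ _) _ => //; rewrite ltry.
(* The points for which k is the last index of a [B] containing them. *)
pose B' k := B k `\` \bigcup_(j in [set j | (k < j)%N]) B j.
have mB' k : borel_set (B' k).
  have -> : B' k = ~` \bigcup_j (if (j <= k)%N then ~` B k else B j).
    apply/seteqP; split=> x.
      move=> [Bk nB] [j _]; case: leqP => [_ //|kj Bj].
      by apply: nB; exists j.
    move=> nB; split.
      by apply: contrapT => Bk; apply: nB; exists 0%N.
    by move=> [j /= kj Bj]; apply: nB; exists j => //; rewrite leqNgt kj.
  by apply: (bC _); apply: bU => j; case: ifP => _ //; exact: bC.
have disjB' k l x : (k < l)%N -> B' k x -> ~ B' l x.
  by move=> kl [_ nB] [Bl _]; apply: nB; exists l.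
(* FMV only constrains positive indices, so A 0 is irrelevant. *)
pose A k := match k with 0 => set0 | 1 => ~` \bigcup_j B' j | k.+2 => B' k end.
have A1 k : (0 < k)%N -> borel_set (A k).
  by case: k => [//|[|k]] _; [apply: bC; apply: bU => j|]; exact: mB'.
have A2 k l : (0 < k)%N -> (0 < l)%N -> k <> l -> A k `&` A l = set0.
  move=> k0 l0 kl; rewrite -subset0 => x [].
  case: k l k0 l0 kl => [|[|k]] [|[|l]] //= _ _ kl.
  - by move=> nB Bl; apply: nB; exists l.
  - by move=> Bk nB; apply: nB; exists k.
  - move=> Bk Bl; have [lk|lk|lk] := ltngtP l k.
    + exact: disjB' lk Bl Bk.
    + exact: disjB' lk Bk Bl.
    + by apply: kl; rewrite lk.
have A3 : \bigcup_(k in [set k | (0 < k)%N]) A k = setT.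
  rewrite -subTset => x _; have [[k _ Bk]|nB] := pselect ((\bigcup_k B' k) x).
    by exists k.+2.
  by exists 1%N.
have := fmv A A1 A2 A3.
have : \forall w \ae P, ~ lim_sup_set Bad w.
  exists (lim_sup_set Bad); split => //; last first.
    by move=> w /= /contrapT.
  by apply: bigcap_measurableType => // k _; apply: bigcup_measurable.
apply: filterS2 => w nBad fin.
have -> : [set x | exists t, (0 < t)%N /\ X t w = x] =
    range (fun t => X t.+1 w).
  apply/seteqP; split => x /=; first by case=> -[|t] [] // _ <-; exists t.
  by case=> t _ <-; exists t.+1.
apply: contrapT => inf.
have [k0 k0P] : exists k0, forall k, (k0 <= k)%N -> ~ Bad k w.
  move/existsNP: nBad => [k0 /not_implyP[_ nBad]]; exists k0 => k kk0 Bw.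
  by apply: nBad; exists k.
have [M MP] : exists M, forall k, (0 < k)%N ->
    (exists t, (0 < t)%N /\ A k (X t w)) -> (k <= M)%N.
  have /finite_seqP[s sE] := fin.
  exists (\max_(i <- s) i) => k k1 Ak.
  apply: (@leq_bigmax_seq _ s xpredT id) => //.
  by have : [set` s] k by rewrite -sE.
(* Beyond [k0] the set [B k] is hit, and beyond [M] hitting it will exceed the bound on visited
   indices. *)
pose k := maxn k0 M.
have [_ _ _ /(_ w (k0P _ (leq_maxl k0 M)))[/(_ inf)[t Bt] _]] := HB k.
have [l [kl Bl lmax]] : exists l, [/\ (k <= l)%N, B l (X t.+1 w) &
    forall j, (l < j)%N -> ~ B j (X t.+1 w)].
  (* For j > t the time t is among the first j, which [B j] avoids once j >= [k0]; so a last index l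
     exists. *)
  have bnd j : `[< B j (X t.+1 w) >] -> (j <= maxn k0 t)%N.
    move=> /asboolP Bj; rewrite leqNgt gtn_max; apply/negP => /andP[kj tj].
    have [_ _ _ /(_ w (k0P _ (ltnW kj)))[_ /(_ t tj)]] := HB j.
    exact.
  have ex1 : exists j, `[< B j (X t.+1 w) >] by exists k; apply/asboolP.
  case: (ex_maxnP ex1 bnd) => l /asboolP Bl lmax; exists l; split => //.
    by apply: lmax; apply/asboolP.
  by move=> j lj Bj; have := lmax j (asboolT Bj); rewrite leqNgt lj.
(* [B' l] is the set of index l+2 in the partition [A], yet l >= k >= M. *)
have : (l.+2 <= M)%N.
  apply: MP => //; exists t.+1; split => //=; split => // -[j /= lj].
  exact: lmax.
by rewrite leqNgt ltnS (leq_trans _ (leqW kl))// leq_maxr.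
Qed.

Theorem theorem5 (R : realType) (T : pseudoMetricType R)
  (hT : hausdorff_space T) (sepT : separable T)
  (d : measure_display) (Omega : measurableType d) (P : probability Omega R)
  (X : nat -> Omega -> T) (hX : process X) :
  FMV P X <-> FS P X.
Proof. by split; [exact: FMV_FS|exact: FS_FMV]. Qed.
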